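(* Let $(X,d)$ be an unbounded metric space. A subset $Y$ of $X$ is large if and only if $\bigtriangleup_p(Y) \ne \varnothing$ for every $p\in X^\#$.
   Context: For $x\in X$, $r\geqslant 0$, $A\subseteq X$: $B(x,r)=\{y\in X: d(x,y)\leqslant r\}$ and $B(A,r)=\bigcup_{a\in A}B(a,r)$. A subset $V\subseteq X$ is bounded if $V\subseteq B(x,r)$ for some $x\in X$, $r\geqslant 0$. A subset $Y\subseteq X$ is large if $X=B(Y,r)$ for some $r\geqslant 0$. $\beta X$ denotes the set of all ultrafilters on $X$ (the Stone-Čech compactification of $X$ with the discrete topology). For $Y\subseteq X$, $Y^\#=\{p\in\beta X: Y\in p \text{ and each } P\in p \text{ is unbounded in } X\}$; in particular $X^\#$ is the set of all ultrafilters on $X$ all of whose members are unbounded. For $p,q\in X^\#$ write $p\parallel q$ if there is $r\geqslant 0$ such that $B(Q,r)\in p$ for each $Q\in q$ (this is an equivalence relation, called parallel equivalence). Put $\overline{\overline{p}}=\{q\in X^\#: p\parallel q\}$ and, for $Y\subseteq X$, $\bigtriangleup_p(Y)=\overline{\overline{p}}\cap Y^\#$. *)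

(* Defs.v *)
From HB Require Import structures.
From mathcomp Require Import all_boot all_order all_algebra.
From mathcomp Require Import boolp classical_sets filter reals topology.
From mathcomp Require Import metric_structure.

Set Implicit Arguments.
Unset Strict Implicit.
Unset Printing Implicit Defensive.

Import Order.TTheory GRing.Theory Num.Theory.
Local Open Scope classical_set_scope.
Local Open Scope ring_scope.

Section Defs.
Context {R : realType} {X : metricType R}.
Implicit Types (x : X) (r : R) (A V Y : set X) (p q : set_system X).

(* B(x, r).  MathComp-Analysis' [ball] is the open ball, and its [closed_ball]
   is the closure of the open ball, which may be smaller than this set. *)
Definition cball x r : set X := [set y | mdist x y <= r].

(* B(A, r) *)
Definition cballs A r : set X := \bigcup_(a in A) cball a r.

Definition metric_bounded V : Prop := exists x r, 0 <= r /\ V `<=` cball x r.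

Definition large Y : Prop := exists r, 0 <= r /\ [set: X] = cballs Y r.

(* Y^#, for Y a subset of X; in particular X^# is [sharp setT]. *)
Definition sharp Y : set (set_system X) :=
  [set p | [/\ UltraFilter p, p Y & forall P, p P -> ~ metric_bounded P]].

(* p || q *)
Definition parallel p q : Prop :=
  exists r, 0 <= r /\ forall Q, q Q -> p (cballs Q r).

Definition parallel_class p : set (set_system X) :=
  [set q | sharp [set: X] q /\ parallel p q].

Definition triangle p Y : set (set_system X) := parallel_class p `&` sharp Y.

End Defs.

(* Main.v *)
(** If [X = B(Y, r)], pick [f : X -> Y] moving points by at most [r]: the
image of [p] under [f] is an ultrafilter on [Y] parallel to [p].  Conversely,
if [Z] is nonempty and not large, the complements of the balls [B(Z, r)]
generate a proper filter, whose members remain so after removal of bounded sets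
because [B(Z, r)] absorbs every bounded set for large [r].  An ultrafilter [p]
extending it lies in [X^#], and no ultrafilter containing [Z] is parallel to
[p]. *)
Require Import Defs.
From HB Require Import structures.
From mathcomp Require Import all_boot all_order all_algebra.
From mathcomp Require Import boolp classical_sets filter reals topology.
From mathcomp Require Import metric_structure.
Import Order.TTheory GRing.Theory Num.Theory.
Local Open Scope classical_set_scope.
Local Open Scope ring_scope.

(** Maximality: if a larger filter [G] contains [A] but [F] omits the preimage of [A], then [F]
    contains the preimage of the complement, so [G] would contain both [A] and its complement. *)
Lemma fmap_ultra (T U : Type) (f : T -> U) (F : set_system T) :
  UltraFilter F -> UltraFilter (f @ F).
Proof.
move=> FU; split=> [|G GF FG]; first exact: fmap_proper_filter.
rewrite eqEsubset; split=> // A GA.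
have [//|FnA] := in_ultra_setVsetC (f @^-1` A) FU.
have GnA : G (~` A) by apply: FG.
by have /filter_ex[x []] : G (A `&` ~` A) by exact: filterI.
Qed.

Section Large.
Set Implicit Arguments.
Unset Strict Implicit.
Context {R : realType} {X : metricType R}.
Implicit Types (x y : X) (r s : R) (A V Y Z : set X) (p q : set_system X).

Lemma cballs_le Z r s : r <= s -> cballs Z r `<=` cballs Z s.
Proof. by move=> rs x [z Zz zx]; exists z => //; exact: le_trans zx rs. Qed.

Lemma metric_bounded_cballs Z V : Z !=set0 -> metric_bounded V ->
  exists r, 0 <= r /\ V `<=` cballs Z r.
Proof.
move=> [z Zz] [x [r [r0 Vr]]]; exists (mdist z x + r); split.
  by rewrite addr_ge0 ?mdist_ge0.
move=> v /Vr xv; exists z => //; rewrite /cball/=.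
apply: le_trans (metric_triangle z x v) _.
by rewrite lerD2l.
Qed.

Definition cocoarse_filter Z : set_system X :=
  [set A | exists r, 0 <= r /\ ~` A `<=` cballs Z r].

Lemma cocoarse_filter_proper Z : ~ large Z -> ProperFilter (cocoarse_filter Z).
Proof.
move=> Zsmall; split.
  move=> [r [r0]]; rewrite setC0 => Zr; apply: Zsmall; exists r; split=> //.
  by rewrite eqEsubset.
split.
- by exists 0; split=> //; rewrite setCT; exact: sub0set.
- move=> A B [r [r0 Ar]] [s [s0 Bs]]; exists (Num.max r s).
  split; first by rewrite le_max r0.
  rewrite setCI subUset; split.
    by apply: subset_trans Ar _; apply: cballs_le; rewrite le_max lexx.
  by apply: subset_trans Bs _; apply: cballs_le; rewrite le_max lexx orbT.
- move=> A B AB [r [r0 Ar]]; exists r; split=> //.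
  by apply: subset_trans Ar; exact: subsetC.
Qed.

Lemma sharp_avoiding_cballs Z : Z !=set0 -> ~ large Z ->
  exists p, sharp [set: X] p /\ forall r, 0 <= r -> ~ p (cballs Z r).
Proof.
move=> Z0 /cocoarse_filter_proper/ultraFilterLemma[p [pU Zp]].
have pZ r : 0 <= r -> ~ p (cballs Z r).
  move=> r0 pr; have pnr : p (~` cballs Z r).
    by apply: Zp; exists r; rewrite setCK; split.
  by have /filter_ex[x []] : p (cballs Z r `&` ~` cballs Z r) by exact: filterI.
exists p; split=> //; split=> //; first exact: filterT.
(* A bounded member would lie in some [cballs Z r], which [p] avoids. *)
move=> P pP /(metric_bounded_cballs Z0)[r [r0 Pr]].
exact: (pZ _ r0 (filterS Pr pP)).
Qed.

(** Displacement at most [r] makes the preimage of a bounded set bounded, so a bounded member of the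
    image would yield one of [p]. *)
Lemma sharp_fmap (f : X -> X) r p : (forall x, mdist (f x) x <= r) ->
  sharp [set: X] p -> sharp [set: X] (f @ p).
Proof.
move=> fr [pU _ pb]; split; [exact: fmap_ultra|exact: filterT|].
move=> P pP [x [s [s0 Ps]]]; apply: (pb _ pP); exists x, (s + r); split.
  (* Here [r] is nonnegative because it dominates a distance. *)
  by rewrite addr_ge0// (le_trans (mdist_ge0 (f x) x)).
move=> y /Ps xfy; rewrite /cball/=; apply: le_trans (metric_triangle x (f y) y) _.
exact: lerD.
Qed.

(** Each [x] with [f x] in [Q] lies within [r] of [f x], so the preimage of [Q] sits inside
    [cballs Q r]. *)
Lemma parallel_fmap (f : X -> X) r p : 0 <= r ->
  (forall x, mdist (f x) x <= r) -> Filter p -> parallel p (f @ p).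
Proof.
move=> r0 fr pF; exists r; split=> // Q.
apply: (@filterS _ p _ (f @^-1` Q)) => x Qfx.
by exists (f x) => //; exact: fr.
Qed.

Lemma large_triangle Y p : large Y -> sharp [set: X] p -> triangle p Y !=set0.
Proof.
move=> [r [r0 YX]] pX; have [pU _ _] := pX.
have /choice[f Yf] : forall x, exists y, Y y /\ mdist y x <= r.
  move=> x; have [y Yy yx] : cballs Y r x by rewrite -YX.
  by exists y.
have fr x : mdist (f x) x <= r by have [] := Yf x.
have fpX := sharp_fmap fr pX; have [fpU _ fpb] := fpX.
exists (f @ p); split; split=> //; first exact: (parallel_fmap r0 fr).
apply: (@filterS _ p _ setT) => [x _|]; last exact: filterT.
by have [] := Yf x.
Qed.

End Large.

Theorem theorem4p1 (R : realType) (X : metricType R)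
    (X_unbounded : ~ metric_bounded [set: X]) (Y : set X) :
  large Y <-> forall p : set_system X, sharp [set: X] p -> triangle p Y != set0.
Proof.
split=> [Ylarge p pX|Ytri]; first exact/set0P/large_triangle.
apply: contrapT => Ysmall.
(* If [X] were empty, [Y] would be large with radius 0. *)
have [x0 _] : [set: X] !=set0.
  apply/set0P/eqP => X0; apply: Ysmall; exists 0; split=> //.
  by rewrite eqEsubset X0; split=> // x _; rewrite -X0.
(* Enlarging [Y] by a point covers the case [Y = set0]. *)
have [Z [YZ Z0 Zsmall]] : exists Z, [/\ Y `<=` Z, Z !=set0 & ~ large Z].
  have [YE|/set0P Y0] := eqVneq Y set0; last by exists Y; split.
  exists [set x0]; rewrite YE.
  split=> [||[r [r0 Xr]]]; [exact: sub0set|by exists x0|].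
  (* A large singleton would make [X] a single ball. *)
  apply: X_unbounded; exists x0, r; split=> //.
  by rewrite Xr => x [_ ->].
have [p [pX pZ]] := sharp_avoiding_cballs Z0 Zsmall.
have /set0P[q [[_ [r [r0 qp]]] [_ qY _]]] := Ytri p pX.
have [pU _ _] := pX.
(* Parallelism puts [cballs Y r], hence [cballs Z r], in [p]. *)
apply: (pZ r r0); apply: filterS (qp _ qY) => x [y Yy yx].
by exists y => //; exact: YZ.
Qed.
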